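(* Let $M$ be a projective $\mathbf{B}$-semimodule, where $\mathbf{B}$ is the Boolean semifield. The following conditions are equivalent: (i) $\mathbf{E}_M$ is ideal-simple; (ii) $\mathbf{E}_M$ is simple; (iii) $\mathbf{E}_M$ is congruence-simple; (iv) the semilattice $M$ is a finite distributive lattice.
   Context: A semiring $(R,+,\cdot,0,1)$ consists of a commutative monoid $(R,+,0)$ and a monoid $(R,\cdot,1)$ such that multiplication distributes over addition on both sides and $0r=0=r0$ for all $r\in R$. An ideal is an additive submonoid closed under left and right multiplication by elements of $R$. A semiring $R$ is ideal-simple if $0$ and $R$ are its only ideals; congruence-simple if the diagonal and the universal relation $R^2$ are its only congruences; simple if it is both. $\mathbf{B}=\{0,1\}$ is the Boolean semifield ($1+1=1$). A (unital) $\mathbf{B}$-semimodule is the same thing as an idempotent commutative monoid $(M,+,0)$, i.e. a join-semilattice with least element $0$ under $x\le y\iff x+y=y$. A $\mathbf{B}$-semimodule is projective if it is a retract of a free $\mathbf{B}$-semimodule (a direct sum of copies of $\mathbf{B}$). $\mathbf{E}_M$ is the semiring of all endomorphisms of $(M,+,0)$, with pointwise addition and composition. ''$M$ is a finite distributive lattice'' refers to the order $\le$ above. *)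

(* Defs.v *)
From HB Require Import structures.
From mathcomp Require Import all_boot all_order all_algebra finmap.
From mathcomp Require Import boolp classical_sets cardinality.

Set Implicit Arguments.
Unset Strict Implicit.
Unset Printing Implicit Defensive.

Import GRing.Theory.

Local Open Scope classical_set_scope.
Local Open Scope ring_scope.

(* An alias is needed: the canonical ring structure of bool is the field F_2. *)
Definition boole : Type := bool.

HB.instance Definition _ := Choice.on boole.
HB.instance Definition _ := GRing.isNmodule.Build boole orbA orbC orFb.

Fact boole_nontrivial : (true : boole) != 0.
Proof. by []. Qed.

HB.instance Definition _ := GRing.Nmodule_isComNzSemiRing.Build boole
  andbA andbC andTb andb_orl andFb boole_nontrivial.

(* The direct sum of I copies of R, i.e. the free R-semimodule on I. *)
Definition free_semimod (R : pzSemiRingType) (I : choiceType) : Type :=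
  {fsfun I -> R with 0}.

Section FreeSemimod.
Variables (R : pzSemiRingType) (I : choiceType).
Implicit Types f g h : {fsfun I -> R with 0}.

HB.instance Definition _ := Choice.on (free_semimod R I).

Definition fs_add f g : {fsfun I -> R with 0} :=
  [fsfun i in (finsupp f `|` finsupp g)%fset => f i + g i].

Definition fs_scale (a : R) f : {fsfun I -> R with 0} :=
  [fsfun i in finsupp f => a * f i].

Definition fs_zero : {fsfun I -> R with 0} := [fsfun].

Lemma fs_addE f g i : fs_add f g i = f i + g i.
Proof.
rewrite fsfunE inE; case: finsuppP => [_|//]; case: finsuppP => //= _.
by rewrite addr0.
Qed.

Lemma fs_scaleE a f i : fs_scale a f i = a * f i.
Proof. by rewrite fsfunE; case: finsuppP => // _; rewrite mulr0. Qed.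

Lemma fs_zeroE i : fs_zero i = 0.
Proof. exact: fsfun0E. Qed.

Fact fs_addA : associative fs_add.
Proof. by move=> f g h; apply/fsfunP => i; rewrite !fs_addE addrA. Qed.

Fact fs_addC : commutative fs_add.
Proof. by move=> f g; apply/fsfunP => i; rewrite !fs_addE addrC. Qed.

Fact fs_add0 : left_id fs_zero fs_add.
Proof. by move=> f; apply/fsfunP => i; rewrite fs_addE fs_zeroE add0r. Qed.

HB.instance Definition _ :=
  GRing.isNmodule.Build (free_semimod R I) fs_addA fs_addC fs_add0.

Fact fs_scaleA a b f : fs_scale a (fs_scale b f) = fs_scale (a * b) f.
Proof. by apply/fsfunP => i; rewrite !fs_scaleE mulrA. Qed.

Fact fs_scale0 f : fs_scale 0 f = fs_zero.
Proof. by apply/fsfunP => i; rewrite fs_scaleE fs_zeroE mul0r. Qed.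

Fact fs_scale1 : left_id 1 fs_scale.
Proof. by move=> f; apply/fsfunP => i; rewrite fs_scaleE mul1r. Qed.

Fact fs_scaleDr : right_distributive fs_scale fs_add.
Proof.
by move=> a f g; apply/fsfunP => i; rewrite !(fs_scaleE, fs_addE) mulrDr.
Qed.

Fact fs_scaleDl f a b : fs_scale (a + b) f = fs_add (fs_scale a f) (fs_scale b f).
Proof. by apply/fsfunP => i; rewrite !(fs_scaleE, fs_addE) mulrDl. Qed.

HB.instance Definition _ :=
  GRing.Nmodule_isLSemiModule.Build R (free_semimod R I)
    fs_scaleA fs_scale0 fs_scale1 fs_scaleDr fs_scaleDl.

End FreeSemimod.

Definition projective (R : pzSemiRingType) (M : lSemiModType R) : Prop :=
  exists (I : choiceType) (s : {linear M -> free_semimod R I})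
    (r : {linear free_semimod R I -> M}), cancel s r.

Definition Endo (M : nmodType) : Type := {additive M -> M}.

Section Endo.
Variable M : nmodType.
Implicit Types f g h : {additive M -> M}.

HB.instance Definition _ := gen_eqMixin (Endo M).
HB.instance Definition _ := gen_choiceMixin (Endo M).

Lemma endoP f g : f =1 g -> f = g.
Proof.
case: f g => f [[pf]] [g [[pg]]] /= /funext fg; case: _ / fg in pg *.
by rewrite (Prop_irrelevance pf pg).
Qed.

Definition endo_zero : {additive M -> M} := @GRing.null_fun M M.
Definition endo_add f g : {additive M -> M} := f \+ g.
Definition endo_one : {additive M -> M} := @idfun M.
Definition endo_mul f g : {additive M -> M} := f \o g.

Fact endo_addA : associative endo_add.
Proof. by move=> f g h; apply: endoP => x /=; rewrite addrA. Qed.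

Fact endo_addC : commutative endo_add.
Proof. by move=> f g; apply: endoP => x /=; rewrite addrC. Qed.

Fact endo_add0 : left_id endo_zero endo_add.
Proof. by move=> f; apply: endoP => x /=; rewrite add0r. Qed.

HB.instance Definition _ :=
  GRing.isNmodule.Build (Endo M) endo_addA endo_addC endo_add0.

Fact endo_mulA : associative endo_mul.
Proof. by move=> f g h; apply: endoP. Qed.

Fact endo_mul1l : left_id endo_one endo_mul.
Proof. by move=> f; apply: endoP. Qed.

Fact endo_mul1r : right_id endo_one endo_mul.
Proof. by move=> f; apply: endoP. Qed.

Fact endo_mulDl : left_distributive endo_mul endo_add.
Proof. by move=> f g h; apply: endoP. Qed.

Fact endo_mulDr : right_distributive endo_mul endo_add.
Proof. by move=> f g h; apply: endoP => x /=; rewrite raddfD. Qed.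

Fact endo_mul0l : left_zero endo_zero endo_mul.
Proof. by move=> f; apply: endoP. Qed.

Fact endo_mul0r : right_zero endo_zero endo_mul.
Proof. by move=> f; apply: endoP => x /=; rewrite raddf0. Qed.

HB.instance Definition _ :=
  GRing.Nmodule_isPzSemiRing.Build (Endo M) endo_mulA endo_mul1l endo_mul1r
    endo_mulDl endo_mulDr endo_mul0l endo_mul0r.

End Endo.

Section Simple.
Variable R : pzSemiRingType.

Definition is_ideal (J : set R) : Prop :=
  [/\ J 0, forall x y, J x -> J y -> J (x + y),
      forall r x, J x -> J (r * x) & forall r x, J x -> J (x * r)].

Definition ideal_simple : Prop :=
  forall J : set R, is_ideal J -> J = [set 0] \/ J = setT.

Definition is_congruence (c : R -> R -> Prop) : Prop :=
  [/\ forall x, c x x, forall x y, c x y -> c y x,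
      forall x y z, c x y -> c y z -> c x z,
      forall x x' y y', c x x' -> c y y' -> c (x + y) (x' + y')
    & forall x x' y y', c x x' -> c y y' -> c (x * y) (x' * y')].

Definition congruence_simple : Prop :=
  forall c : R -> R -> Prop, is_congruence c ->
    (forall x y, c x y <-> x = y) \/ (forall x y, c x y).

Definition simple : Prop := ideal_simple /\ congruence_simple.

End Simple.

Section SemilatticeOrder.
Variable M : lSemiModType boole.
Implicit Types x y z : M.

Definition sle x y : Prop := x + y = y.

Lemma addBxx x : x + x = x.
Proof. by rewrite -{1 2}[x]scale1r -scalerDl scale1r. Qed.

Lemma sle_refl x : sle x x.
Proof. exact: addBxx. Qed.

Lemma sle_anti x y : sle x y -> sle y x -> x = y.
Proof. by rewrite /sle addrC => -> . Qed.

Lemma sle_trans y x z : sle x y -> sle y z -> sle x z.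
Proof. by rewrite /sle => xy yz; rewrite -yz addrA xy. Qed.

(* + is the join of M, so only the meet has to be provided. *)
Lemma sle_join x y z : sle (x + y) z <-> sle x z /\ sle y z.
Proof.
rewrite /sle; split=> [<-|[xz yz]]; last by rewrite -addrA yz.
by split; rewrite !addrA ?addBxx// (addrC y x) -(addrA x) addBxx.
Qed.

Definition finite_distributive_lattice : Prop :=
  finite_set [set: M] /\
  exists meet : M -> M -> M,
    (forall x y z, sle z (meet x y) <-> sle z x /\ sle z y) /\
    (forall x y z, meet x (y + z) = meet x y + meet x z).

End SemilatticeOrder.

(* Main.v *)
Require Import Defs.
From HB Require Import structures.
From mathcomp Require Import all_boot all_order all_algebra.
From mathcomp Require Import finmap.
From mathcomp Require Import boolp classical_sets cardinality.

(** Write [e_{a,b}] for the endomorphism sending [x] to [0] if [x <= a] and to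
[b] otherwise. Composing a nonzero endomorphism with two such maps gives any
[e_{a,b}], so every nonzero ideal contains all of them; likewise, if a
congruence identifies two distinct endomorphisms, it identifies some nonzero
[e_{0,b}] with [0], so that ideal-simplicity implies congruence-simplicity.

The endomorphisms with bounded range form an ideal containing all [e_{a,b}].
If the Bourne congruence of this ideal identifies [1] with [0], then [M] has a
greatest element.

A retraction of finite subsets of [I] onto [M], with section [s] and
retraction [r], makes principal lower sets finite and provides the distributive
meet [r (s x :&: s y)]. When [M] is finite, [{x | i \notin s x}] has a greatest
element [a_i], and [1] is the finite sum of the [e_{a_i, r {i}}]; hence a
nonzero ideal is everything. *)

Set Implicit Arguments.
Unset Strict Implicit.
Unset Printing Implicit Defensive.

Import GRing.Theory.

Local Open Scope classical_set_scope.
Local Open Scope ring_scope.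

(** * Ideals and congruences of a semiring *)

Section Congruence.
Variable R : pzSemiRingType.
Implicit Types (c : R -> R -> Prop) (J : set R) (x y z : R).

Lemma congruence_class0_ideal c :
  is_congruence c -> is_ideal [set x | c x 0].
Proof.
move=> [crefl _ _ cD cM]; split=> [|x y cx cy|z x cx|z x cx] /=.
- exact: crefl.
- by rewrite -[0]addr0; exact: cD.
- by rewrite -(mulr0 z); exact: cM.
- by rewrite -(mul0r z); exact: cM.
Qed.

(** The usual form [x + j = y + k] with [j], [k] in [J] reduces to this one when addition is
    idempotent, as in [Endo M]: add [j + k] to both sides. *)
Definition bourne J x y : Prop :=
  exists2 j, J j & x + j = y + j.

Lemma bourne_congruence J :
  is_ideal J -> is_congruence (bourne J).
Proof.
move=> [J0 JD Jl Jr].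
have mull z x y : bourne J x y -> bourne J (z * x) (z * y).
  by move=> [j Jj xy]; exists (z * j); [exact: Jl|rewrite -!mulrDr xy].
have mulr z x y : bourne J x y -> bourne J (x * z) (y * z).
  by move=> [j Jj xy]; exists (j * z); [exact: Jr|rewrite -!mulrDl xy].
have tr x y z : bourne J x y -> bourne J y z -> bourne J x z.
  move=> [j Jj xy] [k Jk yz]; exists (j + k); first exact: JD.
  by rewrite addrA xy addrAC yz -addrA (addrC k).
split=> [x|x y|//|x x' y y'|x x' y y' xx' yy'].
- by exists 0.
- by move=> [j Jj xy]; exists j.
- move=> [j Jj xx'] [k Jk yy']; exists (j + k); first exact: JD.
  by rewrite addrACA xx' yy' addrACA.
- by apply: tr (mulr y _ _ xx') _; exact: mull.
Qed.

End Congruence.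

(** * Threshold endomorphisms *)

Section Threshold.
Variable M : lSemiModType boole.
Implicit Types a b x y : M.

Lemma sle0x x : sle 0 x.
Proof. exact: add0r. Qed.

Lemma sle_addr x y : sle x (x + y).
Proof. by rewrite /sle addrA addBxx. Qed.

Lemma additive_sle (N : lSemiModType boole) (f : {additive M -> N}) x y :
  sle x y -> sle (f x) (f y).
Proof. by rewrite /sle -raddfD => ->. Qed.

Lemma sle_sum (T : eqType) (r : seq T) (P : pred T) (F : T -> M) i :
  i \in r -> P i -> sle (F i) (\sum_(j <- r | P j) F j).
Proof.
elim: r => // j r IH; rewrite in_cons big_cons => /orP[/eqP <-|ir] Pi.
  by rewrite Pi; exact: sle_addr.
case: (P j); last exact: IH.
by apply: sle_trans (IH ir Pi) _; rewrite addrC; exact: sle_addr.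
Qed.

Definition threshold a b x : M := if x + a == a then 0 else b.

(** A join lies below [a] exactly when both terms do; if neither does, [b + b = b] is needed. *)
Fact threshold_is_nmod_morphism a b : nmod_morphism (threshold a b).
Proof.
split=> [|x y]; rewrite /threshold; first by rewrite add0r eqxx.
have -> : (x + y + a == a) = (x + a == a) && (y + a == a).
  by apply/eqP/andP => [/sle_join[/eqP ? /eqP ?]|[/eqP ? /eqP ?]] //;
     apply/sle_join.
by case: eqP => _; case: eqP => _ /=; rewrite ?add0r ?addr0 ?addBxx.
Qed.

HB.instance Definition _ a b :=
  GRing.isNmodMorphism.Build M M (threshold a b)
    (threshold_is_nmod_morphism a b).

Definition thr a b : {additive M -> M} := threshold a b.

Lemma thr_le a b x : sle x a -> thr a b x = 0.
Proof. by move=> xa; rewrite /thr /= /threshold xa eqxx. Qed.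

Lemma thr_nle a b x : ~ sle x a -> thr a b x = b.
Proof. by move=> xa; rewrite /thr /= /threshold; case: eqP. Qed.

Lemma thr_sle a b x : sle (thr a b x) b.
Proof.
case: (pselect (sle x a)) => xa.
  by rewrite thr_le //; exact: sle0x.
by rewrite thr_nle //; exact: sle_refl.
Qed.

(** The inner threshold feeds [f] only [0] or [u]; the outer one kills [f 0 = 0] and sends [f u] to
    [b]. *)
Lemma thr_comp a b u (f : {additive M -> M}) c :
    ~ sle (f u) c -> endo_mul (thr c b) (endo_mul f (thr a u)) = thr a b.
Proof.
move=> fuc; apply: endoP => x /=; case: (pselect (sle x a)) => xa.
  by rewrite -!/(thr _ _ _) !(thr_le _ xa) !raddf0.
by rewrite -!/(thr _ _ _) !(thr_nle _ xa) thr_nle.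
Qed.

Lemma nsle0 x : x <> 0 -> ~ sle x 0.
Proof. by rewrite /sle addr0. Qed.

Lemma thr_neq0 b : b <> 0 -> thr 0 b <> 0 :> Endo M.
Proof.
move=> b0 /(congr1 (fun f : {additive M -> M} => f b)) /=.
by rewrite -/(thr 0 b b) thr_nle //; exact: nsle0.
Qed.

Lemma endo_neqP (f g : {additive M -> M}) :
  f <> g -> exists u, ~ sle (f u) (g u) \/ ~ sle (g u) (f u).
Proof.
move=> fg; apply: contrapT => /forallNP h; apply: fg; apply: endoP => u.
by have /not_orP[/contrapT ? /contrapT ?] := h u; exact: sle_anti.
Qed.

Lemma ideal_thr (J : set (Endo M)) a b :
  is_ideal J -> J != [set 0] -> J (thr a b).
Proof.
move=> [J0 _ Jl Jr] /eqP JN0.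
have [f Jf f0] : exists2 f, J f & f <> 0.
  apply: contrapT => h; apply: JN0; apply/seteqP; split=> [f Jf /=|_ -> //].
  by apply: contrapT => f0; apply: h; exists f.
have [u fu] : exists u, (f : {additive M -> M}) u <> 0.
  by apply: contrapT => /forallNP h; apply: f0; apply: endoP => u;
     apply: contrapT (h u).
by rewrite -(thr_comp a b (nsle0 fu)); apply/Jl/Jr.
Qed.

Lemma ideal_simple_congruence_simple :
  ideal_simple (Endo M) -> congruence_simple (Endo M).
Proof.
move=> simp c congc; have [crefl csym ctrans cD cM] := congc.
case: (pselect (forall f g, c f g -> f = g)) => [h|].
  by left=> f g; split=> [/h//|->].
move=> /existsNP[f /existsNP[g /not_implyP[cfg fg]]]; right.
(* By antisymmetry, distinct values fail to be comparable in at least one direction; symmetry of [c]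
   lets [f] and [g] be exchanged. *)
wlog [u fgu] : f g cfg fg /
    exists u, ~ sle ((f : {additive M -> M}) u) ((g : {additive M -> M}) u).
  move=> H; have [u [fgu|gfu]] := endo_neqP fg.
  - by apply: (H f g) => //; exists u.
  - by apply: (H g f); [exact: csym|exact/nesym|exists u].
set b := (f : {additive M -> M}) u in fgu *.
have b0 : b <> 0 by move=> b0; apply: fgu; rewrite b0; exact: sle0x.
(* Compose both maps with [thr 0 u] on the right and [thr a b] on the left, where [a = g u]. From
   [f] this gives [thr 0 b]; from [g] it gives [0], since [g] only receives arguments below [u]. *)
have cb : c (thr 0 b) 0.
  set a := (g : {additive M -> M}) u in fgu *.
  rewrite -(thr_comp 0 b fgu).
  have <- : endo_mul (thr a b) (endo_mul g (thr 0 u)) = 0 :> Endo M.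
    apply: endoP => x /=; rewrite -!/(thr _ _ _) thr_le //.
    exact: additive_sle (thr_sle _ _ _).
  by apply: (cM); [exact: crefl|apply: cM; [|exact: crefl]].
have [Z|Z] := simp _ (congruence_class0_ideal congc).
  have : [set x | c x 0] (thr 0 b : Endo M) by [].
  by rewrite Z => /(thr_neq0 b0).
have c0 (h : Endo M) : c h 0 by have : setT h by []; rewrite -Z.
by move=> h k; apply: ctrans (c0 h) _; exact: csym.
Qed.

(** * Bounded endomorphisms *)

Definition bounded_endo : set (Endo M) :=
  [set f | exists m, forall x, sle ((f : {additive M -> M}) x) m].

Lemma bounded_endo_ideal : is_ideal bounded_endo.
Proof.
split=> [|f g [m fm] [n gn]|h f [m fm]|h f [m fm]].
- by exists 0 => x; exact: sle_refl.
- exists (m + n) => x /=; apply/sle_join; split.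
    by apply: sle_trans (fm x) _; exact: sle_addr.
  by apply: sle_trans (gn x) _; rewrite addrC; exact: sle_addr.
- by exists ((h : {additive M -> M}) m) => x /=; exact: additive_sle.
- by exists m => x /=; exact: fm.
Qed.

Lemma bounded_thr a b : bounded_endo (thr a b).
Proof. by exists b => x; exact: thr_sle. Qed.

Lemma congruence_simple_bounded :
  congruence_simple (Endo M) -> exists m : M, forall x, sle x m.
Proof.
move=> /(_ _ (bourne_congruence bounded_endo_ideal))[diag|univ].
  (* By idempotency [thr 0 x] is congruent to [0], with itself as witness, so here [M] is
     trivial. *)
  exists 0 => x; suff -> : x = 0 by exact: sle_refl.
  apply: contrapT => x0; apply: (thr_neq0 x0); apply/diag.
  exists (thr 0 x); first exact: bounded_thr.
  by apply: endoP => y /=; rewrite addBxx add0r.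
(* The relation [1 + j = 0 + j] says that [x] lies below [j x]. *)
have [j [m jm] e] := univ 1 0; exists m => x; apply: sle_trans (jm x).
by have /(congr1 (fun f : {additive M -> M} => f x)) /= := e; rewrite add0r.
Qed.

End Threshold.

(** * Coordinates and basis of a free semimodule *)

Section FreeSemimodule.
Variables (R : pzSemiRingType) (I : choiceType).
Implicit Types f g : free_semimod R I.

Definition coord i f : R := (f : {fsfun I -> R with 0}) i.

Fact coord_is_nmod_morphism i : nmod_morphism (coord i).
Proof. by split=> [|f g]; [exact: fs_zeroE|exact: fs_addE]. Qed.

HB.instance Definition _ i :=
  GRing.isNmodMorphism.Build (free_semimod R I) R (coord i)
    (coord_is_nmod_morphism i).

Lemma coordP f g : (forall i, coord i f = coord i g) -> f = g.
Proof. by move=> fg; apply/fsfunP. Qed.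

Definition fs_unit i : free_semimod R I := [fsfun j in [fset i]%fset => 1].

Lemma coord_unit i j : coord j (fs_unit i) = (j == i)%:R.
Proof. by rewrite /coord fsfunE inE; case: eqP. Qed.

(** Allowing [D] to exceed the support lets one index set serve all vectors at once. *)
Lemma fs_unit_sum (D : {fset I}) f : (finsupp f `<=` D)%fset ->
  f = \sum_(i <- D) coord i f *: fs_unit i.
Proof.
move=> /fsubsetP fD; apply: coordP => j; rewrite raddf_sum /=.
have E i : coord j (coord i f *: fs_unit i) = coord i f * (j == i)%:R.
  by rewrite -coord_unit; exact: fs_scaleE.
rewrite (eq_bigr _ (fun i _ => E i)); have [jD|jD] := boolP (j \in D).
  rewrite (bigD1_seq j) ?fset_uniq //= eqxx mulr1 big1 ?addr0 // => i.
  by rewrite eq_sym => /negPf ->; rewrite mulr0.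
rewrite big1_seq => [|i /andP[_ iD]].
  by rewrite /coord fsfun_dflt //; apply: contra jD; exact: fD.
by case: eqP => [ji|]; [rewrite ji iD in jD|rewrite mulr0].
Qed.

End FreeSemimodule.

Arguments fs_unit {R I} i.

(** * Retracts of free Boolean semimodules *)

Section Projective.
Variables (M : lSemiModType boole) (I : choiceType).
Variables (s : {linear M -> free_semimod boole I}).
Variables (r : {linear free_semimod boole I -> M}).
Hypothesis sK : cancel s r.
Implicit Types (x y z : M) (f g h : free_semimod boole I).

Lemma sle_coord f g : sle f g <-> forall i, coord i f -> coord i g.
Proof.
split=> [fg i fi|fg]; first by rewrite -fg raddfD; apply/orP; left.
apply: coordP => i; rewrite raddfD /=; move: (fg i).
by case: (coord i f) => [/(_ isT) ->|_].
Qed.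

(** Intersection of supports, the product of [boole] being conjunction. *)
Definition fs_meet f g : free_semimod boole I :=
  [fsfun i in finsupp f => coord i f * coord i g].

Lemma coord_meet i f g :
  coord i (fs_meet f g) = coord i f * coord i g.
Proof.
rewrite {1}/coord fsfunE; case: finsuppP => // fi.
have -> : coord i f = 0 by exact: fsfun_dflt.
by rewrite mul0r.
Qed.

Lemma sle_meet h f g : sle h (fs_meet f g) <-> sle h f /\ sle h g.
Proof.
split=> [/sle_coord hfg|[/sle_coord hf /sle_coord hg]].
  by split; apply/sle_coord => i /hfg; rewrite coord_meet => /andP[].
by apply/sle_coord => i hi; rewrite coord_meet; apply/andP; split; auto.
Qed.

Lemma fs_meetDr f g h : fs_meet f (g + h) = fs_meet f g + fs_meet f h.
Proof.
by apply: coordP => i; rewrite coord_meet !raddfD /= !coord_meet mulrDr.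
Qed.

Definition pmeet x y : M := r (fs_meet (s x) (s y)).

(** Additive maps are monotone, so [s] and [r] carry the inequalities back and forth, and
    [r (s x) = x]. *)
Lemma sle_pmeet x y z : sle z (pmeet x y) <-> sle z x /\ sle z y.
Proof.
have [le1 le2] : sle (pmeet x y) x /\ sle (pmeet x y) y.
  have /sle_meet[h1 h2] := sle_refl (fs_meet (s x) (s y)).
  by split; [rewrite -{2}[x]sK|rewrite -{2}[y]sK]; exact: additive_sle.
split=> [zxy|[zx zy]].
  by split; [exact: sle_trans le1|exact: sle_trans le2].
rewrite -[z]sK; apply: additive_sle; apply/sle_meet.
by split; exact: additive_sle.
Qed.

Lemma pmeetDr x y z : pmeet x (y + z) = pmeet x y + pmeet x z.
Proof. by rewrite /pmeet !raddfD /= fs_meetDr raddfD. Qed.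

Lemma finsupp_sle f g : sle f g -> (finsupp f `<=` finsupp g)%fset.
Proof.
move=> /sle_coord fg; apply/fsubsetP => i; rewrite !mem_finsupp.
by move: (fg i); rewrite /coord; case: (f i) => // /(_ isT) ->.
Qed.

(** An element [x] is determined by the support of [s x], which by monotonicity is a subset of the
    finite support of [s m]. *)
Lemma bounded_finite m : (forall x, sle x m) -> finite_set [set: M].
Proof.
move=> mP; pose supp (x : M) : {fset I} := finsupp (s x).
have supp_inj : injective supp.
  move=> x y xy; apply: (can_inj sK); apply: coordP => i.
  have : (i \in supp x) = (i \in supp y) by rewrite xy.
  by rewrite !mem_finsupp /coord; case: (s x i); case: (s y i).
have fin := finite_preimage (in2W supp_inj) (finite_fset (fpowerset (supp m))).
apply: sub_finite_set fin => x _ /=; rewrite fpowersetE.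
exact/finsupp_sle/additive_sle.
Qed.

Lemma one_sum_thr : finite_set [set: M] ->
  exists (D : {fset I}) (a : I -> M) (b : I -> M),
    1 = \sum_(i <- D) (thr (a i) (b i) : Endo M).
Proof.
move=> finM; pose T := fset_set [set: M].
have inT x : x \in T by rewrite in_fset_set // inE.
pose a i := \sum_(x <- T | ~~ coord i (s x)) x.
(* The sum of all elements is the greatest one, so [D] contains the support of every [s x]. *)
pose D := finsupp (s (\sum_(x <- T) x)).
exists D, a, (fun i => r (fs_unit i)).
(* Coordinate [i] of [s] is additive, so it vanishes at the join [a i] and hence at everything below
   it. *)
have aP i x : sle x (a i) <-> ~~ coord i (s x).
  split=> [/(additive_sle s)/sle_coord h|]; last first.
    exact: (sle_sum (P := fun x => ~~ coord i (s x)) id).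
  apply/negP => /h; rewrite /a raddf_sum raddf_sum /=.
  by rewrite big1 // => y /negPf.
apply: endoP => x; rewrite -[LHS]sK.
have xD : (finsupp (s x) `<=` D)%fset.
  by apply/finsupp_sle/additive_sle; apply: (sle_sum (P := xpredT) id (inT x)).
rewrite [s _](fs_unit_sum xD) raddf_sum /=.
pose ev (f : Endo M) := (f : {additive M -> M}) x.
have -> : forall F : I -> Endo M,
    ((\sum_(i <- D) F i : Endo M) : {additive M -> M}) x =
    \sum_(i <- D) (F i : {additive M -> M}) x.
  by move=> F; apply: (big_morph ev).
(* By [aP], the scalar [coord i (s x)] is [0] exactly when the threshold at [a i] kills [x], so the
   sums agree term by term. *)
apply: eq_bigr => i _; rewrite linearZ /=.
case E : (coord i (s x)).
  by rewrite scale1r thr_nle // => /aP; rewrite E.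
by rewrite scale0r thr_le //; apply/aP; rewrite E.
Qed.

Lemma finite_ideal_simple : finite_set [set: M] -> ideal_simple (Endo M).
Proof.
move=> /one_sum_thr[D [a [b e1]]] J idJ.
have [->|JN0] := eqVneq J [set 0]; [by left|right].
have [J0 JD _ Jr] := idJ.
have J1 : J 1.
  rewrite e1; apply: (big_ind J) => // i _; exact: ideal_thr.
by apply/seteqP; split=> // f _; rewrite -[f]mul1r; exact: Jr.
Qed.

End Projective.

Theorem corollary3p8 (M : lSemiModType boole) (projM : projective M) :
  [<-> ideal_simple (Endo M);
       simple (Endo M);
       congruence_simple (Endo M);
       finite_distributive_lattice M].
Proof.
have [I [s [r sK]]] := projM.
tfae=> [iM|[]//|/congruence_simple_bounded[m mP]|[finM _]].
- by split=> //; exact: ideal_simple_congruence_simple.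
- split; first exact: (bounded_finite sK mP).
  by exists (pmeet s r); split; [exact: sle_pmeet|exact: pmeetDr].
- exact: (finite_ideal_simple sK).
Qed.
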